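(* Assume $cov(\mathcal{M})>\aleph_1$ and $\mathfrak{c}=\omega_2$. Then there is a first countable regular space $X$ such that player two has a winning strategy in $G^{\omega_1}_1(\mathcal{O},\mathcal{O})$ on $X$ and $d(X)>\aleph_1$.
   Context: $cov(\mathcal{M})$ is the least cardinality of a family of meager subsets of the real line covering the real line; $\mathfrak{c}=2^{\aleph_0}$. $d(X)$ is the density of $X$, i.e. the least cardinality of a dense subset. $G^{\omega_1}_1(\mathcal{O},\mathcal{O})$ on $X$ is the two-player game with $\omega_1$ many innings in which, at inning $\alpha<\omega_1$, player one picks an open cover $\mathcal{U}_\alpha$ of $X$ and then player two picks an open set $U_\alpha\in\mathcal{U}_\alpha$. Player two wins if $\{U_\alpha:\alpha<\omega_1\}$ is a cover of $X$. *)

(* Defs.v *)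
From HB Require Import structures.
From mathcomp Require Import all_boot all_order all_algebra.
From mathcomp Require Import wochoice.
From mathcomp Require Import all_classical all_reals topology normedtype.
Import numFieldNormedType.Exports.

Set Implicit Arguments.
Unset Strict Implicit.
Unset Printing Implicit Defensive.

Local Open Scope classical_set_scope.
Local Open Scope card_scope.

(** As in [mathcomp.classical.cardinality], a cardinal is represented by any set
having that cardinality. *)

Definition card_lt T U (A : set T) (B : set U) : bool :=
  (A #<= B) && ~~ (B #<= A).
Notation "A '#<' B" := (card_lt A B) (at level 79) : card_scope.

(** [least_card P] is a member of [P] of least cardinality; it thus stands for
the cardinal min {|A| : A in P}. The default value [setT] is used only if [P]
is empty, see [least_cardP]. *)
Definition least_card T (P : set (set T)) : set T :=
  xget setT [set A | P A /\ forall B, P B -> A #<= B].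

Lemma card_le_inj T U (A : set T) (B : set U) (f : T -> U) :
  set_fun A B f -> set_inj A f -> A #<= B.
Proof.
by move=> fAB finj; have /injfunPex[g] : exists2 f, set_fun A B f & set_inj A f
  by [exists f]; exact: inj_card_le.
Qed.

Lemma least_cardP T (P : set (set T)) : P !=set0 ->
  P (least_card P) /\ forall B, P B -> least_card P #<= B.
Proof.
move=> [A0 PA0].
suff /xgetPex : exists A, P A /\ forall B, P B -> A #<= B by apply.
pose I := {A | P A}.
(* families of choice functions that pairwise differ at every index *)
pose Q (F : set (I -> T)) := (forall f, F f -> forall i : I, sval i (f i)) /\
  (forall f g, F f -> F g -> forall i, f i = g i -> f = g).
have [F [[FA Finj] Fmax]] : exists F, Q F /\ forall G, F `<` G -> ~ Q G.
  apply: Zorn_bigcup => C CQ Ctot.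
  split=> [f [X CX Xf]|f g [X CX Xf] [Y CY Yg]].
    by have [+ _] := CQ _ CX; apply.
  have [XY|YX] := Ctot _ _ CX CY.
    by have [_ +] := CQ _ CY; apply => //; exact: XY.
  by have [_ +] := CQ _ CX; apply => //; exact: YX.
have [[i iF]|] := pselect (exists i : I, sval i `<=` (fun f => f i) @` F).
  exists (sval i); split=> [|B PB]; first exact: (svalP i).
  apply: (card_le_trans (subset_card_le iF)).
  apply: (card_le_trans (card_image_le _ _)).
  pose j : I := exist _ B PB.
  apply: (@card_le_inj _ _ _ _ (fun f => f j)) => [f Ff|f g].
    exact: (FA _ Ff j).
  by move=> /set_mem Ff /set_mem Fg; exact: Finj.
move=> /forallNP noi.
have /choice[h hP] : forall i : I, exists x, sval i x /\ forall f, F f -> f i <> x.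
  move=> i; have /existsNP[x /not_implyP[ix nx]] := noi i.
  by exists x; split=> // f Ff fx; apply: nx; exists f.
exfalso; apply: (Fmax (F `|` [set h])).
  split; first by move=> f Ff; left.
  by move=> /(_ h (or_intror erefl)) /(hP (exist _ _ PA0)).2; exact.
split=> [f [/FA //|-> i]|f g]; first exact: (hP i).1.
move=> [Ff|->] [Fg|->] i // e; first exact: Finj Ff Fg _ e.
- by case: ((hP i).2 _ Ff e).
- by case: ((hP i).2 _ Fg (esym e)).
Qed.

Lemma card_le_total T U (A : set T) (B : set U) : (A #<= B) || (B #<= A).
Proof.
pose A' : set (T + U) := inl @` A; pose B' : set (T + U) := inr @` B.
have AA' : A #<= A'
  by apply: (@card_le_inj _ _ _ _ inl) => [x|x y _ _ []//]; exists x.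
have BB' : B #<= B'
  by apply: (@card_le_inj _ _ _ _ inr) => [x|x y _ _ []//]; exists x.
have A'A : A' #<= A := card_image_le _ _.
have B'B : B' #<= B := card_image_le _ _.
have [|hC Cle] := @least_cardP _ [set C | C = A' \/ C = B'].
  by exists A'; left.
case: hC Cle => -> Cle; apply/orP; [left|right].
- by apply: card_le_trans AA' _; apply: card_le_trans B'B; apply: Cle; right.
- by apply: card_le_trans BB' _; apply: card_le_trans A'A; apply: Cle; left.
Qed.

Lemma card_ltNge T U (A : set T) (B : set U) : (A #< B) = ~~ (B #<= A).
Proof.
by rewrite /card_lt; case: (boolP (B #<= A)) (card_le_total A B);
  rewrite ?andbF// orbF andbT.
Qed.

(** [succ_ord T] is the set of those points of [set T], under a fixed
well-order, that have at most |T| predecessors. Ordered by [succ_le], it is a well-order of size larger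
than |T| all of whose proper initial segments have size at most |T|, that is,
an initial ordinal of cardinality |T|^+; see [succ_le_wo], [succ_ord_segment]
and [succ_ord_gt]. *)

Definition set_wo T : rel (set T) := sval (well_ordering_principle (set T)).

Lemma set_wo_wo T : well_order (@set_wo T).
Proof. exact: svalP. Qed.

Definition succ_ord (T : Type) : Type :=
  {x : set T | [set y | set_wo y x /\ y <> x] #<= [set: T]}.

Definition succ_le T : rel (succ_ord T) := fun x y => set_wo (sval x) (sval y).

Lemma well_order_exists T (R : rel T) (A : set T) : well_order R ->
  A !=set0 -> exists x, A x /\ forall y, A y -> R x y.
Proof.
move=> Rwo [a Aa]; have [|x [[xA xm] _]] := Rwo [pred z | `[< A z >]].
  by exists a; apply/asboolP.
exists x; split; first exact/asboolP.
by move=> y Ay; apply: xm; apply/asboolP.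
Qed.

Lemma well_order_anti (T : eqType) (R : rel T) :
  well_order R -> antisymmetric R.
Proof.
by move=> /withinW-/(_ xpredT)/wo_chain_antisymmetric Ra x y; exact: Ra.
Qed.

Lemma well_order_total (T : eqType) (R : rel T) : well_order R -> total R.
Proof. by move=> /withinW-/(_ xpredT)/wo_chainW Rt x y; exact: Rt. Qed.

Lemma well_order_trans (T : eqType) (R : rel T) :
  well_order R -> transitive R.
Proof.
move=> Rwo y x z xy yz; have [|m [mA mm]] :=
    well_order_exists (A := [set w | w = x \/ w = y \/ w = z]) Rwo.
  by exists x; left.
have Ra := well_order_anti Rwo.
case: mA => [mx|[my|mz]]; subst m.
- by apply: mm; right; right.
- by rewrite (Ra x y) ?mm ?xy//; [right; right|left].
- by rewrite -(Ra y z) ?yz ?mm//; right; left.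
Qed.

Lemma succ_le_wo T : well_order (@succ_le T).
Proof.
have wo := @set_wo_wo T; apply: antisymmetric_well_order => [x y xy|A [a Aa]].
  by apply: val_inj; exact: well_order_anti wo _ _ xy.
have [|x [[x' Ax' <-] xm]] :=
    well_order_exists (A := [set sval x | x in [set x | x \in A]]) wo.
  by exists (sval a), a.
by exists x'; split=> // y Ay; apply: xm; exists y.
Qed.

Lemma succ_ord_segment T (x : succ_ord T) :
  [set y | succ_le y x /\ y <> x] #<= [set: T].
Proof.
apply: card_le_trans (svalP x); apply: (@card_le_inj _ _ _ _ sval).
  by move=> y [yx nyx]; split=> // e; apply: nyx; exact: val_inj.
by move=> y z _ _; exact: val_inj.
Qed.

Lemma succ_ord_gt T : [set: T] #< [set: succ_ord T].
Proof.
rewrite card_ltNge; apply/negP => leT.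
pose S : set (set T) := range (@sval (set T) _ : succ_ord T -> set T).
have ST : S #<= [set: T] := card_le_trans (card_image_le _ _) leT.
have [Sall|] := pselect (forall x, S x).
  have /card_leP[f] : [set: set T] #<= [set: T].
    by apply: card_le_trans ST; apply: subset_card_le => x _; exact: Sall.
  pose g x : T := sval (f (SigSub (mem_set (I : setT x)))).
  have ginj : injective g.
    move=> x y /val_inj fxy.
    have := @inj _ _ _ f _ _ (mem_set I) (mem_set I) fxy.
    by move=> [].
  pose D := [set t | exists2 x, g x = t & ~ x t].
  have nD : ~ D (g D) by move=> /[dup] Dg [x /ginj -> ].
  by apply: (nD); exists D.
move=> /existsNP[x0 nx0].
have [|m [nSm mm]] := well_order_exists (A := ~` S) (@set_wo_wo T).
  by exists x0.
apply: nSm; suff h : [set y | set_wo y m /\ y <> m] #<= [set: T].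
  by exists (exist _ m h).
apply: card_le_trans ST; apply: subset_card_le => y [ym nym].
apply: contrapT => /mm my; apply: nym.
by apply: (well_order_anti (@set_wo_wo T)); rewrite ym.
Qed.

Definition omega1 : Type := succ_ord nat.
Definition omega2 : Type := succ_ord omega1.

Definition nowhere_dense (T : topologicalType) (A : set T) :=
  interior (closure A) = set0.

Definition meager (T : topologicalType) (A : set T) :=
  exists2 N : nat -> set T, (forall n, nowhere_dense (N n)) &
    A = \bigcup_n N n.

Definition meager_cover (T : topologicalType) (F : set (set T)) :=
  (forall A, F A -> meager A) /\ \bigcup_(A in F) A = [set: T].

(** cov(M) *)
Definition cov_meager (R : realType) : set (set R) :=
  least_card (@meager_cover R).
Arguments cov_meager R : clear implicits.

Lemma cov_meagerP (R : realType) : meager_cover (cov_meager R).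
Proof.
suff /least_cardP[] : @meager_cover R !=set0 by [].
exists (range (fun x : R => [set x])); split.
- move=> _ [x _ <-]; exists (fun=> [set x]) => [_|]; last first.
    by apply/seteqP; split=> [y yx|y [n _]//]; exists 0%N.
  rewrite /nowhere_dense -(proj1 (closure_id _)); last first.
    exact: (accessible_closed_set1 (hausdorff_accessible (@Rhausdorff R))).
  exact: interior_set1.
- by apply/seteqP; split=> // x _; exists [set x] => //; exists x.
Qed.

Definition first_countable (X : topologicalType) :=
  forall x : X, exists2 B : set (set X), countable B &
    B `<=` nbhs x /\ forall U, nbhs x U -> exists2 V, B V & V `<=` U.

(** d(X) *)
Definition density (X : topologicalType) : set X := least_card (@dense X).
Arguments density X : clear implicits.

Lemma densityP (X : topologicalType) : dense (density X).
Proof.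
suff /least_cardP[] : @dense X !=set0 by [].
by exists setT => O [x Ox] _; exists x.
Qed.

Definition open_cover (X : topologicalType) (U : set (set X)) :=
  U `<=` open /\ \bigcup_(V in U) V = [set: X].

(** In G_1^{omega_1}(O, O), a strategy for player two answers at inning [a]
according to the covers played at the innings [b <= a]. Its own previous moves
are determined by those covers, so they need not be part of its input. *)

Definition initial_play (Y : Type) (a : omega1) : Type :=
  {b : omega1 | succ_le b a} -> Y.

Definition strategy2 (X : Type) : Type :=
  forall a : omega1, initial_play (set (set X)) a -> set X.

Definition answer (X : Type) (s : strategy2 X) (U : omega1 -> set (set X))
    (a : omega1) : set X :=
  s a (fun b => U (sval b)).

(** Whatever open covers player one picks, the answers of player two are legal
moves and cover the space. *)
Definition winning2 (X : topologicalType) (s : strategy2 X) :=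
  forall U : omega1 -> set (set X), (forall a, open_cover (U a)) ->
    (forall a, U a (answer s U a)) /\ \bigcup_a answer s U a = [set: X].

(* Main.v *)
Require Import Defs.
From HB Require Import structures.
From mathcomp Require Import all_boot all_order all_algebra.
From mathcomp Require Import wochoice.
From mathcomp Require Import all_classical all_reals topology normedtype.
Import numFieldNormedType.Exports.

Set Implicit Arguments.
Unset Strict Implicit.
Unset Printing Implicit Defensive.

Local Open Scope classical_set_scope.
Local Open Scope card_scope.

(** Since cov(M) > aleph_1 and there are only c = omega_2 open subsets of the
line, transfinite recursion along omega_2 gives pairwise distinct irrationals
[x a] such that every open set containing the rationals contains all but
aleph_1 of them (an omega_2-Luzin set). The space consists of these points,
made isolated, and of the rationals with their Euclidean neighbourhoods. All
the isolated points lie in every dense set, so the density is omega_2. Player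
two covers the rationals in countably many innings; what is then left has size
at most aleph_1 and is enumerated in the remaining innings. *)

(** * Cardinal arithmetic around [omega1] *)

(** Hilbert's hotel: [A] contains a copy [i] of the naturals, [shift] sends [i n] to [i (2n)], and
    the freed odd places receive [C]. *)
Lemma card_le_setU_countable T U (A : set T) (B C : set U) :
  infinite_set A -> B #<= A -> countable C -> B `|` C #<= A.
Proof.
elim/Ppointed: T => T in A *; first by rewrite emptyE => /(_ (finite_set0 _)).
move=> /infiniteP/pcard_leP[i] /pcard_leP[f] /countable_injP[h hinj].
have iinj m n : i m = i n -> m = n by apply: inj; rewrite inE.
pose shift t := if pselect (exists n, t = i n) is left e
  then i (projT1 (cid e)).*2 else t.
have shiftA t : A t -> A (shift t).
  by rewrite /shift => At; case: pselect => // e; exact: funS.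
have shift_inj : injective shift.
  move=> s t; rewrite /shift; case: pselect => [e|ns]; case: pselect => [e'|nt].
  - case: (cid e) => m sm; case: (cid e') => n tn /= /iinj/double_inj mn.
    by rewrite sm tn mn.
  - by move=> st; case: nt; exists (projT1 (cid e)).*2.
  - by move=> st; case: ns; exists (projT1 (cid e')).*2.
  - by [].
have shift_odd t n : shift t <> i n.*2.+1.
  rewrite /shift; case: pselect => [e|nt] //; last by move=> tn; apply: nt; exists n.*2.+1.
  by move=> /iinj/(congr1 odd) /=; rewrite !odd_double.
pose F u := if pselect (B u) then shift (f u) else i (h u).*2.+1.
apply: (@card_le_inj _ _ _ _ F).
  move=> u _; rewrite /F; case: pselect => [Bu|nBu]; last exact: funS.
  by apply: shiftA; exact: funS.
move=> u v /set_mem BCu /set_mem BCv; rewrite /F.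
have CnB w : (B `|` C) w -> ~ B w -> w \in C by move=> [//|Cw _]; rewrite inE.
case: pselect => [Bu|nBu]; case: pselect => [Bv|nBv] /=.
- by move=> /shift_inj; apply: inj; rewrite inE.
- by move=> /shift_odd.
- by move=> /esym/shift_odd.
- by move=> /iinj [] /double_inj; apply: hinj; exact: CnB.
Qed.

Lemma infinite_omega1 : infinite_set [set: omega1].
Proof. by apply/infiniteP; have /andP[] := succ_ord_gt nat. Qed.

Lemma uncountable_omega1 : ~ countable [set: omega1].
Proof. by have /andP[_ /negP] := succ_ord_gt nat. Qed.

Lemma succ_ord_segment_le T (x : succ_ord T) : infinite_set [set: T] ->
  [set y | succ_le y x] #<= [set: T].
Proof.
move=> Tinf.
have : [set y | succ_le y x] `<=`
    [set y | succ_le y x /\ y <> x] `|` [set x].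
  by move=> y yx; have [->|nyx] := pselect (y = x); [right|left].
move=> /subset_card_le /card_le_trans; apply.
exact: card_le_setU_countable (succ_ord_segment x) (countable1 x).
Qed.

Lemma succ_le_refl T (x : succ_ord T) : succ_le x x.
Proof. by have := well_order_total (@succ_le_wo T) x x; rewrite orbb. Qed.

(** The innings up to some [c n] form a countable union of countable segments, so the remaining set
    is infinite and absorbs them. Spending the innings [c n] thus still leaves player two [omega1]
    many later ones. *)
Lemma omega1_tail (c : nat -> omega1) :
  [set: omega1] #<= [set a | forall n, ~~ succ_le a (c n)].
Proof.
set A := [set a | _]; pose C := \bigcup_n [set a | succ_le a (c n)].
have AC : [set: omega1] `<=` A `|` C.
  move=> a _; have [[n ac]|/forallNP nac] := pselect (exists n, succ_le a (c n)).
    by right; exists n.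
  by left => n; apply/negP.
have Cc : countable C.
  apply: bigcup_countable => // n _.
  exact: succ_ord_segment_le infinite_nat.
apply: card_le_trans (subset_card_le AC) _.
apply: card_le_setU_countable (card_lexx _) (Cc) => Afin.
apply: uncountable_omega1.
apply: sub_countable (subset_card_le AC) _.
by apply: card_le_setU_countable Cc; [exact: infinite_nat|exact: finite_set_countable].
Qed.

(** * Transfinite recursion with choices *)

Lemma well_order_wf (T : eqType) (R : rel T) : well_order R ->
  well_founded (fun x y => R x y /\ x <> y).
Proof.
set lt := (X in well_founded X); move=> Rwo x; apply: contrapT => nx.
have [|m [nm mm]] := well_order_exists (A := [set x | ~ Acc lt x]) Rwo.
  by exists x; exact: nx.
apply: nm; constructor => y [ym nym]; apply: contrapT => /mm my.
by apply: nym; apply: (well_order_anti Rwo); rewrite ym.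
Qed.

(** The earlier values seen at [a] are an image under the function [f] being built, so the
    hypothesis, stated for arbitrary total functions, applies to it; the default [y0] is never
    taken. *)
Lemma well_order_choice (T : eqType) (R : rel T) (Y : choiceType) (y0 : Y)
    (P : T -> set Y -> Y -> Prop) : well_order R ->
  (forall a (f : T -> Y), exists y, P a (f @` [set b | R b a /\ b <> a]) y) ->
  exists f : T -> Y, forall a, P a (f @` [set b | R b a /\ b <> a]) (f a).
Proof.
move=> Rwo Pex; pose lt b a := R b a /\ b <> a.
have wf : well_founded lt by exact: well_order_wf.
pose F a (rec : forall b, lt b a -> Y) :=
  xget y0 (P a [set y | exists b (h : lt b a), y = rec b h]).
pose f := Fix wf (fun=> Y) F; exists f => a.
have prevE : [set y | exists b (h : lt b a), y = f b] =
    f @` [set b | R b a /\ b <> a].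
  by apply/seteqP; split=> [_ [b [h ->]]|_ [b h <-]]; exists b => //; exists h.
have -> : f a = F a (fun b _ => f b).
  apply: (@Fix_eq _ _ wf (fun=> Y) F _ a) => x g h gh; congr F.
  by apply: functional_extensionality_dep => y; apply: functional_extensionality_dep.
by rewrite /F prevE; apply: xgetPex; exact: Pex.
Qed.

(** * A strategy on concentrated spaces *)

(** Inning [c n] is reserved for covering [d n]. The union [W] of these answers is open and contains
    [range d], so at most aleph_1 points escape it; they are treated one by one in the innings later
    than every [c n]. *)
Lemma concentrated_winning2 (X : topologicalType) (d : nat -> X) :
  (forall W : set X, open W -> range d `<=` W -> ~` W #<= [set: omega1]) ->
  exists s : strategy2 X, winning2 s.
Proof.
move=> dconc.
have [c cinj] : exists c : nat -> omega1, injective c.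
  have /infiniteP/card_leP[f] := infinite_omega1.
  exists (fun n => sval (f (SigSub (mem_set (I : setT n))))) => m n /val_inj fmn.
  by have [] := @inj _ _ _ f _ _ (mem_set I) (mem_set I) fmn.
(* At an inning of [A] all the covers [U (c n)] have been played, so [W U] is already known. *)
pose A := [set a | forall n, ~~ succ_le a (c n)].
pose move_at (C : set (set X)) x := xget set0 [set V | C V /\ V x].
have move_atP C x : open_cover C -> C (move_at C x) /\ move_at C x x.
  move=> [_ Ccov]; suff /xgetPex : exists V, C V /\ V x by exact.
  by have : setT x by []; rewrite -Ccov => -[V CV Vx]; exists V.
pose W (U : omega1 -> set (set X)) := \bigcup_n move_at (U (c n)) (d n).
pose enum (S : set X) : omega1 -> X :=
  xget (fun=> d 0%N) [set f | S `<=` f @` A].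
have enumP S : S #<= [set: omega1] -> S `<=` enum S @` A.
  move=> Sle; rewrite /enum.
  suff /xgetPex : exists f : omega1 -> X, S `<=` f @` A by exact.
  have /pfcard_geP[->|[f]] : S #<= A := card_le_trans Sle (omega1_tail c).
    by exists (fun=> d 0%N).
  by exists f => x Sx; have [a Aa <-] := 'surj_f Sx; exists a.
(* The point to be covered at inning [a]. At innings neither in [A] nor of the form [c n] it is
   arbitrary: only the legality of the move matters there. *)
pose target (U : omega1 -> set (set X)) a : X :=
  if pselect (exists n, a = c n) is left e then d (projT1 (cid e))
  else enum (~` W U) a.
have target_c U n : target U (c n) = d n.
  rewrite /target; case: pselect => [e|[]]; last by exists n.
  by case: (cid e) => m /= /cinj ->.
have target_A U a : A a -> target U a = enum (~` W U) a.
  move=> Aa; rewrite /target; case: pselect => [e|//].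
  by exfalso; case: e Aa => n -> /(_ n); rewrite succ_le_refl.
(* Future covers are replaced by [set0]. This does not affect the target at [c n], which ignores the
   covers, nor at innings of [A], where only past covers are read. *)
pose extend a (h : initial_play (set (set X)) a) b :=
  if pselect (succ_le b a) is left ba then h (exist _ b ba) else set0.
pose s : strategy2 X := fun a h => move_at (extend a h a) (target (extend a h) a).
exists s => U Ucov.
have extendE a b : succ_le b a -> extend a (fun b => U (sval b)) b = U b.
  by rewrite /extend; case: pselect.
have ans_c n : answer s U (c n) = move_at (U (c n)) (d n).
  by rewrite /answer /s target_c extendE// succ_le_refl.
have ans_A a : A a -> answer s U a = move_at (U a) (enum (~` W U) a).
  move=> Aa; rewrite /answer /s target_A// extendE ?succ_le_refl//; congr (move_at _ (enum (~` _) _)).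
  apply: eq_bigcupr => n _; rewrite extendE//.
  by have /orP[] := well_order_total (@succ_le_wo nat) (c n) a => //; rewrite (negPf (Aa n)).
split.
  by move=> a; rewrite /answer /s extendE ?succ_le_refl//; apply: (move_atP _ _ _).1.
apply/seteqP; split=> // x _.
have [[n _ Wx]|nWx] := pselect (W U x).
  by exists (c n) => //; rewrite ans_c.
have [|a Aa ax] := enumP (~` W U) _ x nWx.
  apply: dconc => [|_ [n _ <-]]; last by exists n => //; apply: (move_atP _ _ _).2.
  apply: bigcup_open => n _; have [Uop _] := Ucov (c n).
  by apply: Uop; apply: (move_atP _ _ _).1.
by exists a => //; rewrite ans_A// ax; apply: (move_atP _ _ _).2.
Qed.

(** * Michael-type refinements of a topology *)

(** As for the Michael line: the topology on [T] induced from [Y] by [e],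
refined by isolating the points outside [D]. *)
Definition michael (T : Type) (Y : topologicalType) (D : set T) (e : T -> Y) :
  Type := T.

Section michael_topology.
Variables (T : Type) (Y : topologicalType) (D : set T) (e : T -> Y).
Local Notation X := (michael D e).

HB.instance Definition _ := gen_eqMixin X.
HB.instance Definition _ := gen_choiceMixin X.

Definition michael_open (A : set X) := forall t, D t -> A t ->
  exists V : set Y, [/\ open V, V (e t) & e @^-1` V `<=` A].

Let michael_openT : michael_open setT.
Proof. by move=> t _ _; exists setT; split=> //; exact: openT. Qed.

Let michael_openI : setI_closed michael_open.
Proof.
move=> A B Aop Bop t Dt [At Bt].
have [V [Vop Vt VA]] := Aop t Dt At; have [W [Wop Wt WB]] := Bop t Dt Bt.
exists (V `&` W); split=> //; first exact: openI.
by move=> u [/VA Au /WB].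
Qed.

Let michael_open_bigU (I : Type) (f : I -> set X) :
  (forall i, michael_open (f i)) -> michael_open (\bigcup_i f i).
Proof.
move=> fop t Dt [i _ ft]; have [V [Vop Vt Vf]] := fop i t Dt ft.
by exists V; split=> // u /Vf; exists i.
Qed.

HB.instance Definition _ :=
  isOpenTopological.Build X michael_openT michael_openI michael_open_bigU.

Lemma michael_openE (A : set X) : open A = michael_open A.
Proof. by []. Qed.

Lemma michael_open_preimage (V : set Y) : open V -> open (e @^-1` V : set X).
Proof. by rewrite michael_openE => Vop t _ Vt; exists V; split. Qed.

Lemma michael_open1 (t : X) : ~ D t -> open [set t].
Proof. by rewrite michael_openE => nDt u Du /= ut; case: nDt; rewrite -ut. Qed.

Lemma michael_nbhs (t : X) (A : set X) : D t -> nbhs t A ->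
  exists V : set Y, [/\ open V, V (e t) & e @^-1` V `<=` A].
Proof.
move=> Dt; rewrite nbhsE => -[B []]; rewrite michael_openE => Bop Bt BA.
have [V [Vop Vt VB]] := Bop t Dt Bt.
by exists V; split=> //; exact: subset_trans BA.
Qed.

Lemma michael_first_countable : first_countable Y -> first_countable X.
Proof.
move=> Y1 t; have [Dt|nDt] := pselect (D t); last first.
  exists [set [set t]] => //; split.
    by move=> _ ->; apply: open_nbhs_nbhs; split=> //; exact: michael_open1.
  by move=> U Ut; exists [set t] => // _ ->; exact: nbhs_singleton.
have [B Bc [Bt Bsub]] := Y1 (e t).
exists ((fun V => e @^-1` V) @` B); first exact: card_le_trans (card_image_le _ _) Bc.
split=> [_ [V BV <-]|U /(michael_nbhs Dt)[V [Vop Vt VU]]].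
  have := Bt _ BV; rewrite !nbhsE => -[W [Wop Wt] WV].
  exists (e @^-1` W); last by move=> u; exact: WV.
  by split=> //; exact: michael_open_preimage.
have [W BW WV] := Bsub V (open_nbhs_nbhs (conj Vop Vt)).
by exists (e @^-1` W); [exists W|move=> u /WV; exact: VU].
Qed.

Hypothesis e_inj : injective e.

Lemma michael_accessible : accessible_space Y -> accessible_space X.
Proof.
move=> Y1 x y xy; have [|A [Aop Ax Ay]] := Y1 (e x) (e y).
  by apply: contra xy => /eqP/e_inj ->.
exists (e @^-1` A); split; first exact: michael_open_preimage.
  by move: Ax; rewrite !inE.
by move: Ay; rewrite !inE.
Qed.

(** Off [D], the singleton is both open and closed. On [D], a neighbourhood with small closure is
    pulled back from [Y]: since preimages of open sets are open, the closure of a preimage lies in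
    the preimage of the closure. *)
Lemma michael_regular : accessible_space Y -> regular_space Y ->
  regular_space X.
Proof.
move=> Y1 Yreg t A At.
have [Dt|nDt] := pselect (D t); last first.
  exists [set t]; first by apply: open_nbhs_nbhs; split=> //; exact: michael_open1.
  rewrite -(proj1 (closure_id _)).
    by move=> _ ->; exact: nbhs_singleton.
  exact/accessible_closed_set1/michael_accessible.
have [V [Vop Vt VA]] := michael_nbhs Dt At.
have [W Wt WV] := Yreg (e t) V (open_nbhs_nbhs (conj Vop Vt)).
move: Wt; rewrite nbhsE => -[W' [W'op W't] W'W].
exists (e @^-1` W').
  apply: open_nbhs_nbhs; split=> //; exact: michael_open_preimage.
move=> u uW'; apply: VA; apply: WV => N.
rewrite nbhsE => -[N' [N'op N'u] N'N].
have [|v [W'v N'v]] := uW' (e @^-1` N').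
  by apply: open_nbhs_nbhs; split=> //; exact: michael_open_preimage.
by exists (e v); split; [exact: W'W|exact: N'N].
Qed.

End michael_topology.

(** * Dense sets, countable bases and meager sets *)

Lemma dense_isolated (X : topologicalType) (S I : set X) :
  dense S -> (forall x, I x -> open [set x]) -> I `<=` S.
Proof.
move=> Sd Iop x Ix; have [|y [-> //]] := Sd [set x] _ (Iop x Ix).
by exists x.
Qed.

Lemma second_countable_first (Y : topologicalType) :
  @second_countable Y -> first_countable Y.
Proof.
move=> [B Bc [Bop Bb]] y; exists [set U | B U /\ U y].
  by apply: sub_countable Bc; apply: subset_card_le => U [].
split=> [U [BU Uy]|U /Bb[V]]; first exact: open_nbhs_nbhs (conj (Bop _ BU) Uy).
by exists V.
Qed.

Lemma second_countable_real (R : realType) : @second_countable R.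
Proof.
exists (range (fun cr : rat * rat => ball (@ratr R cr.1) (ratr cr.2))).
  exact: card_le_trans (card_image_le _ _) (countableP _).
split=> [_ [cr _ <-]|x U]; first exact: ball_open.
rewrite nbhsE => -[V [Vop /mem_set Vx] VU].
have [c [r [/set_mem cx cV]]] := open_subball_rat Vop Vx.
exists (ball (@ratr R c) (ratr r)); first by split=> //; exists (c, r).
exact: subset_trans VU.
Qed.

(** An open set is the union of the basic sets inside it, so it is determined by their indices under
    [f], coded as a Boolean sequence. *)
Lemma card_open_le (Y : topologicalType) : @second_countable Y ->
  [set U : set Y | open U] #<= [set: nat -> bool].
Proof.
move=> [B /countable_injP[f finj] [Bop Bb]].
pose code (U : set Y) n := `[< exists V, [/\ B V, V `<=` U & f V = n] >].
have codeS U U' : open U -> code U = code U' -> U `<=` U'.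
  move=> Uop UU' x Ux.
  have [V [BV Vx] VU] := Bb x U (open_nbhs_nbhs (conj Uop Ux)).
  have /asboolP[V' [BV' V'U' VV']] : code U' (f V).
    by rewrite -UU'; apply/asboolP; exists V.
  by apply: V'U'; rewrite (finj V' V)// inE.
apply: (@card_le_inj _ _ _ _ code) => // U U' /set_mem Uop /set_mem U'op UU'.
by apply/seteqP; split; apply: codeS.
Qed.

Lemma meagerU (Y : topologicalType) (A B : set Y) :
  nowhere_dense A -> nowhere_dense B -> meager (A `|` B).
Proof.
move=> Asm Bsm; exists (fun n => if n is 0%N then A else B); first by case.
apply/seteqP; split=> [y [Ay|By]|y [[|n] _]]; [| |by left|by right].
- by exists 0%N.
- by exists 1%N.
Qed.

Lemma nowhere_dense1 (R : realType) (x : R) : nowhere_dense [set x].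
Proof.
rewrite /nowhere_dense -(proj1 (closure_id _)); first exact: interior_set1.
exact: (accessible_closed_set1 (hausdorff_accessible (@Rhausdorff R))).
Qed.

Lemma nowhere_denseC (Y : topologicalType) (U : set Y) :
  open U -> dense U -> nowhere_dense (~` U).
Proof.
move=> Uop Ud; rewrite /nowhere_dense -(proj1 (closure_id _)); last exact: open_closedC.
apply: contrapT => /eqP/set0P /Ud /(_ (@open_interior _ _)) [y [/interior_subset]].
by [].
Qed.

(** * An [omega2]-Luzin set on the line *)

(** Otherwise [F] would itself be a meager cover, and minimality would bound [cov_meager R] by [A],
    which serves only as a cardinal. *)
Lemma exists_notin_meager (R : realType) T (A : set T) (F : set (set R)) :
  A #< cov_meager R -> F #<= A -> (forall M, F M -> meager M) ->
  exists x, forall M, F M -> ~ M x.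
Proof.
rewrite card_ltNge => /negP nle FA Fm; apply: contrapT => nx; apply: nle.
apply: card_le_trans FA; apply: (@least_cardP _ (@meager_cover R) _).2.
  by exists (cov_meager R); exact: cov_meagerP.
split=> //; apply/seteqP; split=> // x _; apply: contrapT => nFx.
by apply: nx; exists x => M FM Mx; apply: nFx; exists M.
Qed.

(** The open sets containing the rationals are listed as [u b], with [b] in [omega2], and [x a] is
    chosen inside every [u b] with [b] before [a]. Hence [u b] can miss [x a] only for [a] up to
    [b], an initial segment of size at most aleph_1. *)
Lemma luzin_sequence (R : realType) : [set: omega1] #< cov_meager R ->
  [set: nat -> bool] #<= [set: omega2] ->
  exists x : omega2 -> R, [/\ injective x, forall a q, x a <> ratr q &
    forall U : set R, open U -> range (@ratr R) `<=` U ->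
      ~` (x @^-1` U) #<= [set: omega1]].
Proof.
move=> cov c2.
have [u [uop uall]] : exists u : omega2 -> set R,
    (forall a, open (u a) /\ range (@ratr R) `<=` u a) /\
    forall U, open U -> range (@ratr R) `<=` U -> exists a, u a = U.
  pose S := [set U : set R | open U /\ range (@ratr R) `<=` U].
  have : S #<= [set: omega2].
    apply: card_le_trans c2; apply: card_le_trans (card_open_le (@second_countable_real R)).
    by apply: subset_card_le => U [].
  move=> /pfcard_geP[S0|[f]].
    suff : S setT by rewrite S0.
    by split=> //; exact: openT.
  exists f; split=> [a|U Uop QU]; first exact: (@funS _ _ _ _ f a I).
  have [a _ <-] := 'surj_f (conj Uop QU : S U); by exists a.
have und a : nowhere_dense (~` u a).
  have [ua Qu] := uop a; apply: nowhere_denseC => // O O0 Oop.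
  have [y [Oy Qy]] := dense_rat O0 Oop.
  by exists y; split=> //; exact: Qu.
pose P (a : omega2) (prev : set R) y :=
  [/\ forall q, y <> ratr q, ~ prev y &
      forall b, succ_le b a -> b <> a -> u b y].
have [|x xP] := @well_order_choice omega2 (@succ_le omega1) R 0%R P (@succ_le_wo _).
  (* One meager set per earlier [b] forbids both leaving [u b] and repeating the value at [b]; with
     the countably many rational singletons, [F] still has size at most aleph_1. *)
  move=> a f; pose F := [set ~` u b `|` [set f b] | b in [set b | succ_le b a /\ b <> a]]
    `|` range (fun q : rat => [set ratr q]).
  have [| |y Fy] := @exists_notin_meager _ _ _ F cov.
  - apply: card_le_setU_countable infinite_omega1 _ _.
      exact: card_le_trans (card_image_le _ _) (succ_ord_segment a).
    exact: card_le_trans (card_image_le _ _) (countableP _).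
  - move=> _ [[b _ <-]|[q _ <-]]; first by apply: meagerU => //; exact: nowhere_dense1.
    by rewrite -[X in meager X]setUid; apply: meagerU; exact: nowhere_dense1.
  exists y; split.
  - by move=> q yq; apply: (Fy [set ratr q]); [right; exists q|].
  - move=> [b ba fby]; apply: (Fy (~` u b `|` [set f b])); first by left; exists b.
    by right; rewrite -fby.
  - move=> b ba nba; apply: contrapT => nub.
    by apply: (Fy (~` u b `|` [set f b])); [left; exists b|left].
exists x; split.
- have xlt a b : succ_le a b -> a <> b -> x a <> x b.
    by move=> ab nab xab; have [_ + _] := xP b; apply; exists a.
  move=> a b xab; apply: contrapT => nab.
  have /orP[ab|ba] := well_order_total (@succ_le_wo omega1) a b.
    exact: xlt ab nab xab.
  by apply: xlt ba _ (esym xab) => /esym.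
- by move=> a; have [] := xP a.
- move=> U Uop QU; have [b ubU] := uall U Uop QU.
  apply: card_le_trans (succ_ord_segment_le b infinite_omega1).
  apply: subset_card_le => a nUa.
  have /orP[//|ba] := well_order_total (@succ_le_wo omega1) a b.
  have [-> //|nba] := pselect (b = a); first exact: succ_le_refl.
  by have [_ _ /(_ b ba nba)] := xP a; rewrite ubU.
Qed.

(** * The Michael-type space over the Luzin set *)

Theorem mainTheorem13 (R : realType) :
  [set: omega1] #< cov_meager R ->
  [set: nat -> bool] #= [set: omega2] ->
  exists X : topologicalType,
    [/\ first_countable X,
        accessible_space X /\ regular_space X,
        exists s : strategy2 X, winning2 s &
        [set: omega1] #< density X].
Proof.
move=> cov /card_eqPle[c2 _].
have [x [xinj xQ xluz]] := luzin_sequence cov c2.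
pose e (t : omega2 + rat) : R := match t with inl a => x a | inr q => ratr q end.
pose X := michael (range (@inr omega2 rat)) e.
have e_inj : injective e.
  move=> [a|q] [b|r] /=.
  - by move=> /xinj ->.
  - by move=> /xQ.
  - by move=> /esym/xQ.
  - by move=> /GRing.Theory.fmorph_inj ->.
have R1 : accessible_space R := hausdorff_accessible (@Rhausdorff R).
have inl_open a : open [set (inl a : X)].
  by apply: michael_open1 => -[].
exists X; split.
- exact/michael_first_countable/second_countable_first/second_countable_real.
- split; first exact: michael_accessible.
  by apply: michael_regular => //; exact: uniform_regular.
(* The rationals are enumerated by [unpickle]; codes of no rational give 0, a harmless
   repetition. *)
- apply: (@concentrated_winning2 X (fun n => inr (odflt 0%R (unpickle n)))).
  move=> W Wop dW.
  (* [V] is the largest open set of the line whose preimage lies in [W]. It contains the rationals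
     because [W] is a neighbourhood of each of them, so the Luzin property applies to [V], and [W]
     misses no more points than [V] does. *)
  pose V := \bigcup_(U in [set U : set R | open U /\ e @^-1` U `<=` W]) U.
  have Vop : open V by apply: bigcup_open => U [].
  have QV : range (@ratr R) `<=` V.
    move=> _ [q _ <-].
    have Wq : W (inr q) by apply: dW; exists (pickle q); rewrite //= pickleK.
    have [|U [Uop Uq UW]] := Wop (inr q) _ Wq; first by exists q.
    by exists U.
  apply: card_le_trans (xluz V Vop QV).
  apply: card_le_trans (card_image_le (@inl omega2 rat) _).
  apply: subset_card_le => -[a nWa|q nWq].
    by exists a => // -[U [_ UW] Ua]; apply: nWa; apply: UW.
  by case: nWq; apply: dW; exists (pickle q); rewrite //= pickleK.
- have inl_density : range (inl : omega2 -> X) `<=` density X.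
    by apply: dense_isolated (@densityP X) _ => _ [b _ <-]; exact: inl_open.
  rewrite card_ltNge; apply/negP => dle.
  have /andP[_ /negP] := succ_ord_gt omega1; apply.
  apply: card_le_trans dle; apply: (@card_le_inj _ _ _ _ (inl : omega2 -> X)).
    by move=> a _; apply: inl_density; exists a.
  by move=> a b _ _ [].
Qed.
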